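(* Let $p$ be a prime, $n\in\mathbb{N}$, $m\in\mathbb{N}$, $\mathbf{a}=(a_0,\dots,a_{m-1})\in\{-\infty,0,1,\dots,n\}^m$ and $d\in U_1$. Assume $d^{p^{a_i}}\in U_{i+1}$ for all $0\le i<m$. If $p$ is odd, and if $a_i+j<a_{i+j}$ for all $0\le i<m$ and $1\le j<m-i$ with $a_{i+j}\neq-\infty$, then $X_{\mathbf{a},d,m}$ is an indecomposable $R_mG$-module. If $p=2$, suppose moreover that: (i) if $n=1$, then $a_0=-\infty$; (ii) for all $0\le i<m$ and $1\le j<m-i$ with $a_{i+j}\neq-\infty$ we have $a_i+j<a_{i+j}$, except when $d\notin U_2$, $i=0$ and $a_0=0$, in which case instead $a_j\neq 0$ for all $1\le j<m$; (iii) if $m\ge 2$, $d\in -U_v\setminus -U_{v+1}$ for some $v\ge 2$, and $a_0=0$, then $a_i>i-(v-1)$ for every $i$ with $v\le i<m$ and $a_i\neq-\infty$. Then $X_{\mathbf{a},d,m}$ is an indecomposable $R_mG$-module.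
   Context: $G$ is a cyclic group of order $p^n$ with fixed generator $\sigma$; for $0\le i\le n$, $G_i$ is the quotient of $G$ of order $p^i$. $R_m=\mathbb{Z}/p^m\mathbb{Z}$ and $R_mG$ is the group ring. For $i\in\mathbb{N}$, $U_i=1+p^i\mathbb{Z}$, $U_\infty=\{1\}$, and $-U_v=\{-u:u\in U_v\}$. Conventions: $-\infty<0$, $-\infty+j=-\infty$, $p^{-\infty}=0$, and for an element $x$ of an $R_mG$-module, $\sigma^{p^{-\infty}}x:=0$. For $\mathbf{a}\in\{-\infty,0,\dots,n\}^m$ and $d\in\mathbb{Z}$, $X_{\mathbf{a},d,m}$ is the (additive) $R_mG$-module with generators $y,x_0,\dots,x_{m-1}$ and relations $(\sigma-d)y=\sum_{i=0}^{m-1}p^ix_i$ and $\sigma^{p^{a_i}}x_i=x_i$ for $0\le i<m$ (so $x_i=0$ when $a_i=-\infty$); the integer $d$ acts through its image in $R_m$. *)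

(* Defs.v *)
From HB Require Import structures.
From mathcomp Require Import all_boot all_algebra all_fingroup.
From mathcomp Require Import ring_quotient generic_quotient.

Set Implicit Arguments.
Unset Strict Implicit.
Unset Printing Implicit Defensive.

Import GRing.Theory.

Local Open Scope ring_scope.

(* The group ring R[G] of a finite group G = gT: the element f stands for the
   formal sum of the f x * x, with the convolution product, not the pointwise
   product that {ffun gT -> R} would otherwise carry. *)
Section GroupRing.

Variables (R : finNzRingType) (gT : finGroupType).

Definition gring : Type := {ffun gT -> R}.

HB.instance Definition _ := Finite.on gring.
HB.instance Definition _ := GRing.Zmodule.on gring.

Implicit Types (f g h : gring) (x y z : gT).

Definition gring_elt x : gring := [ffun y => (y == x)%:R].

Definition gring_mul f g : gring :=
  [ffun x => \sum_(y : gT) f y * g (y^-1 * x)%g].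

Lemma gring_mulA : associative gring_mul.
Proof.
move=> f g h; apply/ffunP=> x; rewrite !ffunE.
under eq_bigr => y _ do rewrite ffunE big_distrr /=.
under [RHS]eq_bigr => z _ do rewrite ffunE big_distrl /=.
rewrite [RHS]exchange_big /=; apply: eq_bigr => y _.
rewrite [RHS](reindex_inj (mulgI y)) /=; apply: eq_bigr => z _.
by rewrite mulKg invMg mulrA mulgA.
Qed.

Lemma gring_mul1 : left_id (gring_elt 1%g) gring_mul.
Proof.
move=> f; apply/ffunP=> x; rewrite ffunE (bigD1 1%g) //= ffunE eqxx mul1r.
rewrite invg1 mul1g big1 ?addr0 // => y /negPf y1.
by rewrite ffunE y1 mul0r.
Qed.

Lemma gring_mulr1 : right_id (gring_elt 1%g) gring_mul.
Proof.
move=> f; apply/ffunP=> x; rewrite ffunE (bigD1 x) //= ffunE mulVg eqxx mulr1.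
rewrite big1 ?addr0 // => y yx; rewrite ffunE -eq_mulVg1.
by rewrite (negPf yx) mulr0.
Qed.

Lemma gring_mulDl : left_distributive gring_mul +%R.
Proof.
move=> f g h; apply/ffunP=> x; rewrite !ffunE -big_split /=.
by apply: eq_bigr => y _; rewrite ffunE mulrDl.
Qed.

Lemma gring_mulDr : right_distributive gring_mul +%R.
Proof.
move=> f g h; apply/ffunP=> x; rewrite !ffunE -big_split /=.
by apply: eq_bigr => y _; rewrite ffunE mulrDr.
Qed.

Lemma gring_1neq0 : gring_elt 1%g != 0.
Proof.
apply/eqP => /ffunP/(_ 1%g) /eqP; rewrite !ffunE eqxx.
by rewrite (negPf (oner_neq0 R)).
Qed.

HB.instance Definition _ := GRing.Zmodule_isNzRing.Build gring
  gring_mulA gring_mul1 gring_mulr1 gring_mulDl gring_mulDr gring_1neq0.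

End GroupRing.

Section QuotientModule.

Variables (A : pzRingType) (V : lmodType A) (I : submodClosed V).

(* submodClosed is stated for semimodules; over a ring it gives a subgroup. *)
Definition submod_zmod : {pred V} := I.

Lemma submod_zmod_closed : zmod_closed submod_zmod.
Proof.
split=> [|u v uI vI]; first exact: (rpred0 I).
by rewrite -scaleN1r; apply: (rpredD uI); apply: (rpredZ (-1) vI).
Qed.

HB.instance Definition _ :=
  GRing.isZmodClosed.Build V submod_zmod submod_zmod_closed.

Definition quomod : Type := Quotient.quot submod_zmod.

HB.instance Definition _ := GRing.Zmodule.on quomod.

Definition quomod_pi (v : V) : quomod := (\pi_(Quotient.quot submod_zmod) v)%qT.

Lemma quomod_piP (u v : V) :
  reflect (quomod_pi u = quomod_pi v) (u - v \in I).
Proof.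
rewrite -[_ \in I]/(u - v \in submod_zmod) Quotient.idealrBE.
exact: eqP.
Qed.

Lemma quomod_piK (q : quomod) : quomod_pi (repr q) = q.
Proof. exact: reprK. Qed.

Lemma quomod_piD : {morph quomod_pi : u v / u + v}.
Proof. by move=> u v; rewrite /quomod_pi raddfD. Qed.

Definition quomod_scale (c : A) (q : quomod) : quomod :=
  quomod_pi (c *: repr q).

Lemma quomod_piZ c v : quomod_scale c (quomod_pi v) = quomod_pi (c *: v).
Proof.
by apply/quomod_piP; rewrite -scalerBr rpredZ //; apply/quomod_piP/quomod_piK.
Qed.

Lemma quomod_scaleA a b q :
  quomod_scale a (quomod_scale b q) = quomod_scale (a * b) q.
Proof. by rewrite -[q]quomod_piK !quomod_piZ scalerA. Qed.

Lemma quomod_scale1 : left_id 1 quomod_scale.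
Proof. by move=> q; rewrite -[q]quomod_piK quomod_piZ scale1r. Qed.

Lemma quomod_scaleDr : right_distributive quomod_scale +%R.
Proof.
move=> c q r; rewrite -[q]quomod_piK -[r]quomod_piK -quomod_piD.
by rewrite !quomod_piZ scalerDr quomod_piD.
Qed.

Lemma quomod_scaleDl q : {morph quomod_scale^~ q : a b / a + b}.
Proof.
by move=> a b; rewrite -[q]quomod_piK !quomod_piZ scalerDl quomod_piD.
Qed.

HB.instance Definition _ := GRing.Zmodule_isLmodule.Build A quomod
  quomod_scaleA quomod_scale1 quomod_scaleDr quomod_scaleDl.

End QuotientModule.

(* Submodule generated by a finite family; it is a boolean predicate because
   the ring of coefficients is finite. *)
Section GeneratedSubmodule.

Variables (A : finNzRingType) (V : lmodType A) (I : finType) (r : I -> V).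

Definition gen_submod : {pred V} :=
  [pred v : V | [exists c : {ffun I -> A}, v == \sum_(i : I) c i *: r i]].

Lemma gen_submod_closed : GRing.subsemimod_closed gen_submod.
Proof.
split; first split.
- rewrite inE; apply/existsP; exists [ffun=> 0].
  by rewrite big1 // => i _; rewrite ffunE scale0r.
- move=> u v /existsP[b /eqP->] /existsP[c /eqP->].
  apply/existsP; exists [ffun i => b i + c i]; rewrite -big_split /=.
  by apply/eqP/eq_bigr=> i _; rewrite ffunE scalerDl.
- move=> a v /existsP[c /eqP->].
  apply/existsP; exists [ffun i => a * c i]; rewrite scaler_sumr.
  by apply/eqP/eq_bigr=> i _; rewrite ffunE scalerA.
Qed.

HB.instance Definition _ :=
  GRing.isSubmodClosed.Build A V gen_submod gen_submod_closed.

End GeneratedSubmodule.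

(* The left A-module with k generators and the relators r i. *)
Definition presented_module (A : finNzRingType) (k : nat) (I : finType)
    (r : I -> 'rV[A]_k) : lmodType A :=
  quomod (gen_submod r).

(* Submodules are boolean predicates: this loses nothing on a finite module
   such as those considered here.  The zero module is not indecomposable. *)
Definition indecomposable (A : pzRingType) (M : lmodType A) : Prop :=
  (exists x : M, x != 0) /\
  forall U W : submodClosed M,
    (forall x : M, exists u w : M, [/\ u \in U, w \in W & x = u + w]) ->
    (forall x : M, x \in U -> x \in W -> x = 0) ->
    (forall x : M, x \in U -> x = 0) \/ (forall x : M, x \in W -> x = 0).

(* {-oo} \cup N is encoded as option nat, with None for -oo. *)
Definition ninf_add (e : option nat) (j : nat) : option nat :=
  if e is Some k then Some (k + j)%N else None.

Definition ninf_lt (e f : option nat) : bool :=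
  match e, f with
  | Some k, Some l => (k < l)%N
  | None, Some _ => true
  | _, None => false
  end.

Definition ninf_exp (p : nat) (e : option nat) : nat :=
  if e is Some k then (p ^ k)%N else 0%N.

Definition U (p i : nat) : {pred int} :=
  [pred z : int | ((p ^ i)%:Z %| z - 1)%Z].

Definition negU (p i : nat) : {pred int} := [pred z : int | - z \in U p i].

Section ModuleX.

Variables (gT : finGroupType) (sigma : gT) (p m : nat).

(* 'Z_(p ^ m) is Z/p^m only when 1 < p ^ m. *)
Definition RG : finNzRingType := gring 'Z_(p ^ m) gT.

(* sigma^(p^e), which acts as 0 (and not as sigma^0) when e = -oo. *)
Definition sigma_exp (e : option nat) : RG :=
  if e is Some k then gring_elt _ (sigma ^+ (p ^ k))%g else 0.

Definition gen_y : 'rV[RG]_m.+1 := delta_mx 0 ord0.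
Definition gen_x (i : 'I_m) : 'rV[RG]_m.+1 := delta_mx 0 (lift ord0 i).

Variables (a : 'I_m -> option nat) (d : int).

Definition X_relator (k : option 'I_m) : 'rV[RG]_m.+1 :=
  if k is Some i then sigma_exp (a i) *: gen_x i - gen_x i
  else (gring_elt _ sigma - d%:~R) *: gen_y
       - \sum_(i < m) (p ^ i)%:R *: gen_x i.

Definition X : lmodType RG := presented_module X_relator.

End ModuleX.

(* Main.v *)
(** Let f_i = T^(p^a_i) - 1, or -1 if a_i = -oo, in Z/p^m[T], where T acts as
    sigma.  A combination V_0 y + sum_j V_j x_j vanishes in X iff
    V_0 = tau (T - d) + W (T^(p^n) - 1) and V_j = - p^j tau + C_j f_j for some
    polynomials tau, W, C_j.  Given an idempotent endomorphism e, write
    e y = al y + sum_j be_j x_j and e x_i = ga_i y + sum_j de_ij x_j.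
    Applying e to the relations gives polynomial identities from which the
    regular f_i can be cancelled; evaluating them and their derivatives at
    T = d yields, modulo p and for i, j >= 1 with a_i, a_j finite, ga_i(d) = 0,
    de_ij(d) = 0 for i < j, and de_ii(d) = al(d).  Hence e acts on the quotient
    of X by its radical (p, sigma - 1) X as al(d) plus a nilpotent map, so e is
    0 or 1 there, and by Nakayama's lemma e is 0 or 1.

    The gap conditions on a and d are used in two forms, for a_j finite: the
    p-adic valuation of (f_j / f_i)(d) exceeds j - i when i < j, and
    (T^(p^n) - 1) / f_0 vanishes to order 2 at T = d modulo p when j > 0. *)

From HB Require Import structures.
Require Import Defs.
From mathcomp Require Import all_boot all_algebra all_fingroup.
From mathcomp Require Import cyclic ring zify.

Set Implicit Arguments.
Unset Strict Implicit.
Unset Printing Implicit Defensive.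

Import GRing.Theory.
Local Open Scope ring_scope.

(** * Divisibility by powers of a fixed element *)

Section PowerDivisibility.

Variables (R : comNzRingType) (b : R).

(** In use [b] is p in Z/p^m, hence nilpotent; lower bounds on the [b]-adic order stand in for a
    valuation. *)
Definition pdvd (k : nat) (u : R) : Prop := exists v, u = b ^+ k * v.

Lemma pdvd0 k : pdvd k 0.
Proof. by exists 0; rewrite mulr0. Qed.

Lemma pdvdD k u v : pdvd k u -> pdvd k v -> pdvd k (u + v).
Proof. by move=> [u' ->] [v' ->]; exists (u' + v'); rewrite mulrDr. Qed.

Lemma pdvdN k u : pdvd k u -> pdvd k (- u).
Proof. by move=> [u' ->]; exists (- u'); rewrite mulrN. Qed.

Lemma pdvdB k u v : pdvd k u -> pdvd k v -> pdvd k (u - v).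
Proof. by move=> ku kv; apply: pdvdD ku (pdvdN kv). Qed.

Lemma pdvdMl k u v : pdvd k v -> pdvd k (u * v).
Proof. by move=> [v' ->]; exists (u * v'); rewrite mulrCA. Qed.

Lemma pdvdMr k u v : pdvd k u -> pdvd k (u * v).
Proof. by rewrite mulrC; apply: pdvdMl. Qed.

Lemma pdvd_sum k (I : Type) (r : seq I) (P : pred I) (F : I -> R) :
  (forall i, P i -> pdvd k (F i)) -> pdvd k (\sum_(i <- r | P i) F i).
Proof. by move=> kF; elim/big_ind: _ => //; [exact: pdvd0|exact: pdvdD]. Qed.

Lemma pdvdM k l u v : pdvd k u -> pdvd l v -> pdvd (k + l) (u * v).
Proof.
by move=> [u' ->] [v' ->]; exists (u' * v'); rewrite exprD mulrACA.
Qed.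

Lemma pdvd_exp k : pdvd k (b ^+ k).
Proof. by exists 1; rewrite mulr1. Qed.

Lemma pdvd_leq k l u : (k <= l)%N -> pdvd l u -> pdvd k u.
Proof.
by move=> /subnKC <- [v ->]; exists (b ^+ (l - k) * v); rewrite exprD mulrA.
Qed.

Lemma pdvd_expM k l u : (k <= l)%N -> pdvd (l - k) u -> pdvd l (b ^+ k * u).
Proof. by move=> kl ?; rewrite -(subnKC kl); apply: pdvdM (pdvd_exp k) _. Qed.

End PowerDivisibility.

(** Evaluation at [d] kills a multiple of T - d; differentiating first recovers the value of the
    cofactor. *)
Lemma horner_deriv_XsubC (R : comNzRingType) (d : R) (q : {poly R}) :
  ((q * ('X - d%:P))^`()).[d] = q.[d].
Proof. by rewrite derivM derivXsubC !hornerE subrr mulr0 add0r. Qed.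

(** * An indecomposability criterion for modules presented over polynomials *)

Section PresentedModuleCriterion.

(** In the application [R] is Z/p^m, [b] is p, [N] is p^n, [F] is T^N - 1, and [fin j] says that a_j
    is finite. *)
Variables (R : comNzRingType) (b d : R) (m N : nat).
Hypothesis b_cancel :
  forall k u, (k < m)%N -> pdvd b k.+1 (b ^+ k * u) -> pdvd b 1 u.
Hypothesis b_nilp : b ^+ m = 0.
Hypothesis b_prime :
  forall u v, pdvd b 1 (u * v) -> pdvd b 1 u \/ pdvd b 1 v.
Hypothesis b_nunit : ~ pdvd b 1 1.
Hypothesis d_sub1 : pdvd b 1 (d - 1).

Variable F : {poly R}.
Hypothesis F_d : pdvd b 1 F.[d].
Hypothesis F'_d : pdvd b 1 (F^`()).[d].
Hypothesis F_frob : exists c : {poly R}, ('X - 1) ^+ N = F + b%:P * c.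

Variables (f Psi : 'I_m -> {poly R}) (fin : pred 'I_m).
Hypothesis f_lreg : forall i, GRing.lreg (f i).
Hypothesis f_Psi : forall i, F = Psi i * f i.
Hypothesis f_d : forall j, fin j -> pdvd b j.+1 (f j).[d].
Hypothesis f_Phi : forall i j : 'I_m, (i < j)%N -> fin j ->
  exists2 Phi : {poly R}, f j = Phi * f i & pdvd b (j - i).+1 Phi.[d].
Hypothesis Psi0_split : forall i j : 'I_m,
  i = 0%N :> nat -> (i < j)%N -> fin j ->
  exists A B : {poly R}, [/\ Psi i = A * B, pdvd b 1 A.[d] & pdvd b 1 B.[d]].

Variables (A : pzRingType) (M : lmodType A) (rho : {rmorphism {poly R} -> A}).
Variables (y : M) (x : 'I_m -> M).

(** Coefficients are polynomials rather than elements of [A], so that they can be differentiated and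
    evaluated at [d]; [lin_eq0] measures their ambiguity. *)
Definition lin (V0 : {poly R}) (V : 'I_m -> {poly R}) : M :=
  rho V0 *: y + \sum_j rho (V j) *: x j.

Hypothesis lin_surj : forall z, exists V, z = lin V.1 V.2.
Hypothesis rel_y : rho ('X - d%:P) *: y = \sum_(j < m) rho (b ^+ j)%:P *: x j.
Hypothesis rel_x : forall j, rho (f j) *: x j = 0.
Hypothesis lin_eq0 : forall V0 V, lin V0 V = 0 ->
  exists (tau W : {poly R}) (C : 'I_m -> {poly R}),
    V0 = tau * ('X - d%:P) + W * F /\
    forall j, V j = - (b ^+ j)%:P * tau + C j * f j.
Hypothesis rho_F : rho F = 0.
Hypothesis x_nfin : forall j, ~~ fin j -> x j = 0.

Lemma linZ P V0 V : rho P *: lin V0 V = lin (P * V0) (fun j => P * V j).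
Proof.
rewrite /lin scalerDr scalerA -rmorphM scaler_sumr; congr (_ + _).
by apply: eq_bigr => j _; rewrite scalerA -rmorphM.
Qed.

Lemma linD V0 V W0 W : lin V0 V + lin W0 W = lin (V0 + W0) (fun j => V j + W j).
Proof.
rewrite /lin addrACA rmorphD scalerDl -big_split; congr (_ + _).
by apply: eq_bigr => j _; rewrite rmorphD scalerDl.
Qed.

Lemma linB V0 V W0 W : lin V0 V - lin W0 W = lin (V0 - W0) (fun j => V j - W j).
Proof.
apply/eqP; rewrite subr_eq linD; apply/eqP.
rewrite /lin subrK; congr (_ + _).
by apply: eq_bigr => j _; rewrite subrK.
Qed.

Lemma lin_sum (I : finType) (V0 : I -> {poly R}) (V : I -> 'I_m -> {poly R}) :
  \sum_i lin (V0 i) (V i) = lin (\sum_i V0 i) (fun j => \sum_i V i j).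
Proof.
rewrite /lin big_split /= rmorph_sum scaler_suml exchange_big /=; congr (_ + _).
by apply: eq_bigr => j _; rewrite rmorph_sum scaler_suml.
Qed.

(** Two lifts of the y-coefficient differ by multiples of T - d and of [F], and [b] divides F(d). *)
Lemma lin_inj_y V0 V W0 W : lin V0 V = lin W0 W -> pdvd b 1 (V0.[d] - W0.[d]).
Proof.
move=> /eqP; rewrite -subr_eq0 linB => /eqP/lin_eq0[tau [H [C [e0 _]]]].
have := congr1 (fun q => q.[d]) e0; rewrite !hornerE subrr mulr0 add0r => ->.
exact: pdvdMl.
Qed.

Lemma y_neq0 : y != 0.
Proof.
apply/eqP => y0; apply: b_nunit; rewrite -[1]subr0.
have /lin_inj_y : lin 1 (fun=> 0) = lin 0 (fun=> 0).
  by rewrite /lin y0 !scaler0.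
by rewrite !hornerE.
Qed.

(** * Coefficients of an endomorphism *)

Section Endomorphism.

Variable e : M -> M.
Hypothesis eD : {morph e : u v / u + v}.
Hypothesis eZ : forall c u, e (c *: u) = c *: e u.

Let e0 : e 0 = 0.
Proof. by have := eZ 0 0; rewrite !scale0r. Qed.

Lemma endo_sum (I : finType) (g : I -> M) : e (\sum_i g i) = \sum_i e (g i).
Proof. exact: (big_morph e eD e0). Qed.

Lemma endo_lin V0 V al be ga de :
  e y = lin al be -> (forall i, e (x i) = lin (ga i) (de i)) ->
  e (lin V0 V) = lin (V0 * al + \sum_i V i * ga i)
                     (fun j => V0 * be j + \sum_i V i * de i j).
Proof.
move=> ey ex; rewrite {1}/lin eD eZ ey linZ endo_sum -linD; congr (_ + _).
by rewrite -lin_sum; apply: eq_bigr => i _; rewrite eZ ex linZ.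
Qed.

Section Coefficients.

Variables (al : {poly R}) (be : 'I_m -> {poly R}).
Variables (ga : 'I_m -> {poly R}) (de : 'I_m -> 'I_m -> {poly R}).
Hypotheses (ey : e y = lin al be) (ex : forall i, e (x i) = lin (ga i) (de i)).

(** Applying [e] to f_i x_i = 0 gives a relation with multiplier tau. Its i-th coordinate says b^i
    tau = E f_i with E = C_i - de_ii, so f_i can be cancelled from the y-coordinate and, as f_i
    divides f_j, from the j-th one. *)
Lemma endo_x_rel (i : 'I_m) : exists W E : {poly R},
  [/\ (b ^+ i)%:P * ga i = E * ('X - d%:P) + (b ^+ i)%:P * W * Psi i
    & forall j : 'I_m, (i < j)%N -> fin j -> exists2 c,
        pdvd b (j - i).+1 c & (de i j).[d] = - (b ^+ (j - i)) * E.[d] + c].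
Proof.
have: lin (f i * ga i) (fun j => f i * de i j) = 0.
  by rewrite -linZ -ex -eZ rel_x e0.
case/lin_eq0=> tau [W [C [eg ed]]]; exists W, (C i - de i i).
have bt : (b ^+ i)%:P * tau = (C i - de i i) * f i.
  by rewrite mulrBl (mulrC (de i i)) ed; ring.
split.
  apply: (@f_lreg i); rewrite mulrCA eg (f_Psi i).
  transitivity ((b ^+ i)%:P * tau * ('X - d%:P)
    + (b ^+ i)%:P * W * (Psi i * f i)); first ring.
  by rewrite bt; ring.
move=> j ij fj; have [Phi fPhi Phid] := f_Phi ij fj.
exists ((C j).[d] * Phi.[d]); first exact: pdvdMl.
have -> : de i j = - (b ^+ (j - i))%:P * (C i - de i i) + C j * Phi.
  apply: (@f_lreg i); rewrite ed fPhi -{1}(subnK (ltnW ij)) exprD polyCM.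
  transitivity (- (b ^+ (j - i))%:P * ((b ^+ i)%:P * tau) + C j * (Phi * f i)).
    by ring.
  by rewrite bt; ring.
by rewrite !hornerE.
Qed.

(** This is [e] applied to (T - d) y = sum_k b^k x_k. The x-coordinates are evaluated at [d] at
    once, which removes the terms (T - d) be_j. *)
Lemma endo_y_rel : exists (tau W : {poly R}) (C : 'I_m -> {poly R}),
  (\sum_(k < m) (b ^+ k)%:P * ga k = (al + tau) * ('X - d%:P) + W * F) /\
  forall j : 'I_m, \sum_(k < m) b ^+ k * (de k j).[d] =
    - b ^+ j * tau.[d] + (C j).[d] * (f j).[d].
Proof.
have : lin (\sum_(k < m) (b ^+ k)%:P * ga k - ('X - d%:P) * al)
           (fun j => \sum_(k < m) (b ^+ k)%:P * de k j - ('X - d%:P) * be j)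
         = 0.
  rewrite -linB -linZ -ey -lin_sum -eZ rel_y endo_sum; apply/eqP.
  by rewrite subr_eq0; apply/eqP/eq_bigr => k _; rewrite eZ ex linZ.
case/lin_eq0=> tau [W [C [e1 e2]]]; exists tau, W, C; split.
  by rewrite -[LHS](subrK (('X - d%:P) * al)) e1; ring.
move=> j; have := congr1 (fun q => q.[d]) (e2 j).
rewrite !hornerE subrr mul0r subr0 horner_sum => <-.
by apply: eq_bigr => k _; rewrite !hornerE.
Qed.

(** The y-coordinate of [endo_y_rel] at [d] expresses b^i ga_i(d) through F(d) and the b^k ga_k(d)
    with k != i. All of these are divisible by b^(i+1), and b^i is then cancelled. *)
Lemma endo_x_coef_y i : fin i -> pdvd b 1 (ga i).[d].
Proof.
move=> fi; apply: (@b_cancel i) => //.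
have [tau [W [C [e1 _]]]] := endo_y_rel.
have := congr1 (fun q => q.[d]) e1; rewrite !hornerE subrr mulr0 add0r.
rewrite horner_sum (bigD1 i) //= !hornerE => /(canRL (addrK _)) ->.
(* For k < i the factor b^k is too weak; the gap condition supplies the missing i - k + 1 powers
   through Psi_k = Psi_i Phi. *)
have Psi_d (k : 'I_m) : (k < i)%N -> pdvd b (i - k).+1 (Psi k).[d].
  move=> ki; have [Phi fPhi Phid] := f_Phi ki fi.
  have -> : Psi k = Psi i * Phi.
    by apply: (@f_lreg k); rewrite mulrC -f_Psi (f_Psi i) fPhi; ring.
  by rewrite hornerE; apply: pdvdMl.
apply: pdvdB.
  by apply: pdvdMl; rewrite (f_Psi i) hornerE; apply: pdvdMl (f_d fi).
apply: pdvd_sum => k ki; rewrite !hornerE.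
have [W' [E [e2 _]]] := endo_x_rel k.
have := congr1 (fun q => q.[d]) e2; rewrite !hornerE subrr mulr0 add0r => ->.
have [ltki|] := ltnP k i; last first.
  rewrite leq_eqVlt eq_sym => /orP[/eqP/val_inj kEi|ltik].
    by rewrite kEi eqxx in ki.
  by rewrite -mulrA; apply: pdvdMr; apply: pdvd_leq ltik (pdvd_exp _ _).
rewrite -mulrA; apply: pdvd_expM; first exact: leqW (ltnW _).
by rewrite subSn ?(ltnW ltki) //; apply: pdvdMl (Psi_d _ _).
Qed.

(** The derivative at [d] isolates E(d); the other terms keep the constant factor b^i with i > 0. *)
Lemma endo_x_rel_deriv (i : 'I_m) W E : (0 < i)%N ->
  (b ^+ i)%:P * ga i = E * ('X - d%:P) + (b ^+ i)%:P * W * Psi i ->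
  pdvd b 1 E.[d].
Proof.
move=> i0 /(congr1 (fun q => (q^`()).[d])).
rewrite derivD hornerD horner_deriv_XsubC => /(canLR (addrK _)) <-.
have bi q : pdvd b 1 (((b ^+ i)%:P * q)^`()).[d].
  rewrite derivM derivC mul0r add0r !hornerE.
  by apply: pdvdMr; apply: pdvd_leq i0 (pdvd_exp _ _).
by apply: pdvdB; rewrite -?mulrA; apply: bi.
Qed.

Lemma endo_x_coef_gt (i j : 'I_m) :
  (0 < i)%N -> (i < j)%N -> fin j -> pdvd b 1 (de i j).[d].
Proof.
move=> i0 ij fj; have [W [E [eE /(_ j ij fj)[c cd ->]]]] := endo_x_rel i.
apply: pdvdD; last exact: pdvd_leq cd.
by apply: pdvdMl; apply: endo_x_rel_deriv eE.
Qed.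

(** Three congruences modulo [b] are combined: ga_0'(d) = al(d) + tau(d), ga_0'(d) = E_0(d), and
    de_jj(d) + tau(d) = E_0(d), with tau from the relation of y and E_0 from that of x_0. *)
Lemma endo_x_coef_diag (j : 'I_m) :
  (0 < j)%N -> fin j -> pdvd b 1 ((de j j).[d] - al.[d]).
Proof.
move=> j0 fj; have [tau [W [C [ega ede]]]] := endo_y_rel.
pose i0 : 'I_m := Ordinal (ltn_trans j0 (ltn_ord j)).
have [W0 [E0 [eE0 dE0]]] := endo_x_rel i0.
(* Derivative of the y-coordinate at [d]: only k = 0 survives modulo [b], since F(d) and F'(d)
   vanish there. *)
have ga_al : pdvd b 1 (((ga i0)^`()).[d] - (al + tau).[d]).
  have := congr1 (fun q => (q^`()).[d]) ega.
  rewrite derivD [in RHS]hornerD horner_deriv_XsubC.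
  rewrite raddf_sum horner_sum (bigD1 i0) //= !expr0 mul1r.
  have cancel (u v w : R) : u + v - w - u = v - w by ring.
  move=> /(canRL (addrK _)) ->; rewrite cancel; apply: pdvdB.
    by rewrite derivM hornerE; apply: pdvdD; rewrite hornerE; apply: pdvdMl.
  apply: pdvd_sum => k ki; rewrite derivM derivC mul0r add0r !hornerE.
  by apply: pdvdMr; apply: pdvd_leq (pdvd_exp _ _); rewrite lt0n.
(* At index 0 there is no factor [b] to remove Psi_0; its double zero at [d] modulo [b] makes the
   derivative of W_0 Psi_0 vanish. *)
have ga_E0 : pdvd b 1 (((ga i0)^`()).[d] - E0.[d]).
  have [A0 [B0 [ePsi Ad Bd]]] := @Psi0_split i0 j erefl j0 fj.
  have := congr1 (fun q => (q^`()).[d]) eE0.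
  rewrite !expr0 !mul1r derivD [in RHS]hornerD horner_deriv_XsubC => ->.
  rewrite [E0.[d] + _]addrC addrK ePsi !derivM !(hornerD, hornerM).
  apply: pdvdD; apply: pdvdMl; first exact: pdvdMl Bd.
  by apply: pdvdD; [apply: pdvdMl Bd|apply: pdvdMr Ad].
(* In the j-th coordinate at [d], index j contributes b^j de_jj(d), index 0 contributes - b^j
   E_0(d), and every other index a multiple of b^(j+1). *)
have key : pdvd b 1 ((de j j).[d] + tau.[d] - E0.[d]).
  apply: (@b_cancel j) => //.
  have := ede j; rewrite (bigD1 j) //= (bigD1 i0) /=; last first.
    by rewrite -val_eqE /= eq_sym -lt0n.
  have [c cd ->] := dE0 j j0 fj.
  rewrite expr0 mul1r subn0 => eq1.
  have -> : b ^+ j * ((de j j).[d] + tau.[d] - E0.[d]) =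
    (C j).[d] * (f j).[d] - c
    - \sum_(i < m | (i != j) && (i != i0)) b ^+ i * (de i j).[d].
    move: eq1; set S := \sum_(_ < m | _) _ => eq1.
    have -> : (C j).[d] * (f j).[d] =
      (- b ^+ j * tau.[d] + (C j).[d] * (f j).[d]) + b ^+ j * tau.[d] by ring.
    by rewrite -eq1; ring.
  apply: pdvdB; first apply: pdvdB.
  - exact: pdvdMl (f_d fj).
  - by rewrite subn0 in cd.
  apply: pdvd_sum => i /andP[ij i_n0].
  have i_gt0 : (0 < i)%N by rewrite lt0n.
  have [lt_ij|] := ltnP i j; last first.
    rewrite leq_eqVlt eq_sym => /orP[/eqP/val_inj iEj|ltij].
      by rewrite iEj eqxx in ij.
    by apply: pdvdMr; apply: pdvd_leq ltij (pdvd_exp _ _).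
  have [W' [E [eE /(_ j lt_ij fj)[c' cd' ->]]]] := endo_x_rel i.
  apply: pdvd_expM; first exact: leqW (ltnW _).
  rewrite subSn ?(ltnW lt_ij) //; apply: pdvdD => //.
  rewrite -addn1; apply: pdvdM; first exact: pdvdN (pdvd_exp _ _).
  exact: endo_x_rel_deriv eE.
have -> : (de j j).[d] - al.[d] =
  ((de j j).[d] + tau.[d] - E0.[d]) - (((ga i0)^`()).[d] - E0.[d])
   + (((ga i0)^`()).[d] - (al + tau).[d]) by rewrite hornerD; ring.
by apply: pdvdD => //; apply: pdvdB.
Qed.

End Coefficients.

(** * The radical and Nakayama's lemma for idempotents *)

Definition rad (z : M) : Prop :=
  exists u w, z = rho b%:P *: u + rho ('X - 1) *: w.

Lemma radD z t : rad z -> rad t -> rad (z + t).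
Proof.
move=> [u [w ->]] [u' [w' ->]]; exists (u + u'), (w + w').
by rewrite !scalerDr addrACA.
Qed.

Lemma rad_sum (I : Type) (r : seq I) (P : pred I) (g : I -> M) :
  (forall i, P i -> rad (g i)) -> rad (\sum_(i <- r | P i) g i).
Proof.
move=> radg; elim/big_ind: _ => //; last exact: radD.
by exists 0, 0; rewrite !scaler0 addr0.
Qed.

Lemma rad_scale P z : rad z -> rad (rho P *: z).
Proof.
move=> [u [w ->]]; exists (rho P *: u), (rho P *: w).
by rewrite scalerDr !scalerA -!rmorphM ![P * _]mulrC.
Qed.

Lemma rad_endo z : rad z -> rad (e z).
Proof. by move=> [u [w ->]]; exists (e u), (e w); rewrite eD !eZ. Qed.

(** As d = 1 modulo [b], the ideal (b, T - 1) contains T - d, so it contains P - P(d). *)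
Lemma rad_pdvd (P : {poly R}) z : pdvd b 1 P.[d] -> rad (rho P *: z).
Proof.
move=> [u Pu]; have [v dv] := d_sub1.
have /factor_theorem[Q PQ] : root (P - P.[d]%:P) d.
  by rewrite /root !hornerE subrr.
exists (rho (u%:P - v%:P * Q) *: z), (rho Q *: z).
rewrite !scalerA -!rmorphM -scalerDl -rmorphD; congr (rho _ *: _).
rewrite -(subrK P.[d]%:P P) PQ Pu.
rewrite -(subrK 1 d) dv !expr1 polyCD !polyCM; ring.
Qed.

(** In the relation of y the coefficient of x_0 is b^0 = 1, so x_0 = (T - d) y - sum_(k > 0) b^k
    x_k. *)
Lemma rad_x_ord0 (i : 'I_m) : i = 0%N :> nat -> rad (x i).
Proof.
move=> i0; have := rel_y; rewrite (bigD1 i) //= i0 expr0 rmorph1 scale1r.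
move=> /(canLR (addrK _)) <-; apply: radD.
  by apply: rad_pdvd; rewrite !hornerE subrr; apply: pdvd0.
rewrite -scaleN1r -(rmorph1 rho) -(rmorphN rho); apply: rad_scale.
apply: rad_sum => k ki; apply: rad_pdvd; rewrite hornerE.
by apply: pdvd_leq (pdvd_exp _ _); rewrite lt0n -i0.
Qed.

Hypothesis ee : forall z, e (e z) = e z.

(** Since e e = e, the inclusion of the image in the radical can be iterated. After [N] rounds (T -
    1)^N is a multiple of [b] on the module, because [F] acts as 0; so the image of [e] lies in [b]
    times itself, and b^m = 0. *)
Lemma idem_rad_eq0 : (forall z, rad (e z)) -> forall z, e z = 0.
Proof.
move=> rade.
have step k z : exists u w, e z = rho b%:P *: e u + rho (('X - 1) ^+ k) *: e w.
  elim: k => [|k [u [w ->]]].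
    by exists 0, z; rewrite e0 scaler0 add0r rmorph1 scale1r.
  have [u' [w' ew]] := rade w.
  exists (u + rho (('X - 1) ^+ k) *: u'), w'.
  rewrite -(ee w) ew !(eD, eZ, scalerDr, scalerA) -!rmorphM -exprSr.
  by rewrite addrA [_ * b%:P]mulrC.
have divb z : exists u, e z = rho b%:P *: e u.
  have [u [w ->]] := step N z; have [c ->] := F_frob.
  exists (u + rho c *: w).
  by rewrite rmorphD /= rho_F add0r eD eZ scalerDr scalerA -rmorphM.
have divbk k z : exists u, e z = rho (b%:P ^+ k) *: e u.
  elim: k => [|k [u ->]]; first by exists z; rewrite rmorph1 scale1r.
  by have [w ->] := divb u; exists w; rewrite scalerA -rmorphM exprSr.
move=> z; have [u ->] := divbk m z.
by rewrite -rmorphXn b_nilp !rmorph0 scale0r.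
Qed.

Lemma endo_lifts : exists V : 'I_m -> {poly R} * ('I_m -> {poly R}),
  forall i, e (x i) = lin (V i).1 (V i).2.
Proof. exact: (@fin_all_exists _ _ (fun i V => e (x i) = lin V.1 V.2)). Qed.

(** By [idem_rad_eq0] it suffices that [e] sends the generators into the radical. Rewriting e x_i as
    e (e x_i) allows strong induction on i: terms j < i are covered by induction, and the
    coefficients of y and of x_j, j >= i, lie in (b, T - 1). *)
Lemma idem_eq0 al be : e y = lin al be -> pdvd b 1 al.[d] ->
  forall z, e z = 0.
Proof.
move=> ey al_d; have [V ex] := endo_lifts.
have rad_ex (i : 'I_m) : rad (e (x i)).
  have [k le_ik] := ubnP i; elim: k => // k IHk in i le_ik *.
  have [i0|i_gt0] := posnP i; first exact/rad_endo/rad_x_ord0.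
  have [fi|/x_nfin ->] := boolP (fin i); last first.
    by rewrite e0; exists 0, 0; rewrite !scaler0 addr0.
  rewrite -ee ex /lin eD endo_sum eZ; apply: radD.
    by rewrite -eZ; apply/rad_endo/rad_pdvd; apply: (endo_x_coef_y ey ex fi).
  apply: rad_sum => j _; rewrite eZ.
  have [lt_ji|] := ltnP j i.
    by apply/rad_scale/IHk; apply: leq_trans lt_ji _.
  rewrite leq_eqVlt => /orP[/eqP/val_inj <-|lt_ij].
    rewrite -eZ; apply/rad_endo/rad_pdvd.
    rewrite -(subrK al.[d] (_.[d])); apply: pdvdD => //.
    exact: (endo_x_coef_diag ey ex i_gt0 fi).
  have [fj|/x_nfin ->] := boolP (fin j); last first.
    by rewrite e0 scaler0; exists 0, 0; rewrite !scaler0 addr0.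
  rewrite -eZ; apply/rad_endo/rad_pdvd.
  exact: (endo_x_coef_gt ex i_gt0 lt_ij fj).
have rad_ey : rad (e y).
  rewrite -ee {1}ey /lin eD endo_sum; apply: radD.
    exact/rad_endo/rad_pdvd.
  by apply: rad_sum => j _; rewrite eZ; apply: rad_scale.
apply: idem_rad_eq0 => z; have [[U0 U] ->] := lin_surj z; rewrite /lin /=.
rewrite eD endo_sum eZ; apply: radD; first exact: rad_scale.
by apply: rad_sum => j _; rewrite eZ; apply: rad_scale.
Qed.

(** The y-coefficients of e (e y) = e y give al(d)^2 = al(d) modulo [b], the ga_i(d) being 0 there,
    and [b] is prime. *)
Lemma idem_coef al be : e y = lin al be ->
  pdvd b 1 al.[d] \/ pdvd b 1 (1 - al.[d]).
Proof.
move=> ey; have [V ex] := endo_lifts; apply: b_prime.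
have: lin al be = e (lin al be) by rewrite -ey ee.
rewrite (endo_lin _ _ ey ex) => /lin_inj_y.
rewrite hornerD hornerM horner_sum => h.
rewrite mulrBr mulr1; set S := \sum_(i < m) _ in h.
have -> : al.[d] - al.[d] * al.[d] = al.[d] - (al.[d] * al.[d] + S) + S by ring.
apply: pdvdD => //; apply: pdvd_sum => i _; rewrite hornerM; apply: pdvdMl.
have [fi|nfi] := boolP (fin i); first exact: (endo_x_coef_y ey ex fi).
(* If a_i is infinite then x_i = 0, and ga_i is a y-coefficient of the zero element. *)
rewrite -[_.[d]]subr0 -(horner0 d); apply: (@lin_inj_y _ (V i).2 _ (fun=> 0)).
rewrite -ex (x_nfin nfi) e0 /lin rmorph0 scale0r add0r big1 // => j _.
by rewrite scale0r.
Qed.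

End Endomorphism.

(** The projection [e] onto [U] along [W] is an idempotent endomorphism; by [idem_coef], either [e]
    or its complement satisfies [idem_eq0]. *)
Lemma presented_indecomposable : indecomposable M.
Proof.
split=> [|U W sumUW capUW]; first by exists y; exact: y_neq0.
(* Membership is Boolean, so the component in [U] can be picked by [xchoose]. *)
have dec z : exists u, (u \in U) && (z - u \in W).
  have [u [w [uU wW ->]]] := sumUW z; exists u.
  by rewrite uU addrC addKr wW.
pose e z := xchoose (dec z).
have eU z : e z \in U by have /andP[] := xchooseP (dec z).
have eW z : z - e z \in W by have /andP[] := xchooseP (dec z).
have memB (S : submodClosed M) u v : u \in S -> v \in S -> u - v \in S.
  by move=> uS vS; rewrite -scaleN1r rpredD ?rpredZ.
have e_uniq z u : u \in U -> z - u \in W -> e z = u.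
  move=> uU uW; apply/eqP; rewrite -subr_eq0; apply/eqP/capUW.
    exact: memB.
  have -> : e z - u = (z - u) - (z - e z).
    by rewrite opprB [RHS]addrC addrA subrK.
  exact: memB.
have eD : {morph e : u v / u + v}.
  move=> u v; apply: e_uniq; first by rewrite rpredD.
  by rewrite opprD addrACA rpredD.
have eZ c u : e (c *: u) = c *: e u.
  by apply: e_uniq; rewrite -?scalerBr rpredZ.
have eid u : u \in U -> e u = u.
  by move=> uU; apply: e_uniq => //; rewrite subrr rpred0.
have ee u : e (e u) = e u by apply: eid.
have e0W w : w \in W -> e w = 0.
  by move=> wW; apply: e_uniq; rewrite ?rpred0 ?subr0.
have [[al be] ey] := lin_surj (e y).
case: (idem_coef eD eZ ee ey) => /= al_d.
  by left=> u uU; rewrite -(eid u uU); apply: (idem_eq0 eD eZ ee ey).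
right=> w wW; have <- : w - e w = w by rewrite e0W ?subr0.
have e'y : y - e y = lin (1 - al) (fun j => 0 - be j).
  rewrite -linB -ey; congr (_ - _); rewrite /lin rmorph1 scale1r big1 ?addr0 //.
  by move=> j _; rewrite rmorph0 scale0r.
apply: (@idem_eq0 (fun z => z - e z) _ _ _ _ _ e'y _ w).
- by move=> u v; rewrite eD opprD addrACA.
- by move=> c u; rewrite eZ scalerBr.
- by move=> z; rewrite (e0W _ (eW z)) subr0.
- by rewrite !hornerE.
Qed.

End PresentedModuleCriterion.

(** * The group ring of a cyclic group as a quotient of R[T] *)

Section GroupRingPoly.

Variables (R : finComNzRingType) (gT : finGroupType).

Local Notation RG := (gring R gT).

Definition gring_const (c : R) : RG := [ffun g => c *+ (g == 1%g)].

Lemma gring_const_mul c (u : RG) : gring_const c * u = [ffun g => c * u g].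
Proof.
apply/ffunP => g; rewrite !ffunE (bigD1 1%g) //= ffunE eqxx mulr1n.
rewrite invg1 mul1g big1 ?addr0 // => h /negPf h1.
by rewrite ffunE h1 mulr0n mul0r.
Qed.

Lemma mul_gring_const c (u : RG) : u * gring_const c = [ffun g => u g * c].
Proof.
apply/ffunP => g; rewrite !ffunE (bigD1 g) //= ffunE mulVg eqxx mulr1n.
rewrite big1 ?addr0 // => h hg.
by rewrite ffunE -eq_mulVg1 (negPf hg) mulr0n mulr0.
Qed.

Lemma gring_const_is_zmod_morphism : zmod_morphism gring_const.
Proof. by move=> c d; apply/ffunP => g; rewrite !ffunE mulrnBl. Qed.

Lemma gring_const_is_monoid_morphism : monoid_morphism gring_const.
Proof.
split=> [|c d]; first by apply/ffunP => g; rewrite !ffunE.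
by rewrite gring_const_mul; apply/ffunP => g; rewrite !ffunE mulrnAr.
Qed.

HB.instance Definition _ :=
  GRing.isZmodMorphism.Build R RG gring_const gring_const_is_zmod_morphism.
HB.instance Definition _ :=
  GRing.isMonoidMorphism.Build R RG gring_const gring_const_is_monoid_morphism.

Lemma gring_eltM (g h : gT) :
  (gring_elt R g : RG) * gring_elt R h = gring_elt R (g * h)%g.
Proof.
apply/ffunP => k; rewrite !ffunE (bigD1 g) //= !ffunE eqxx mul1r.
rewrite (can2_eq (mulKVg g) (mulKg g)) big1 ?addr0 // => l /negPf lg.
by rewrite ffunE lg mul0r.
Qed.

Lemma gring_eltX (g : gT) k :
  (gring_elt R g : RG) ^+ k = gring_elt R (g ^+ k)%g.
Proof.
elim: k => [|k IHk]; first by rewrite expr0 expg0.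
by rewrite exprS IHk gring_eltM expgS.
Qed.

Variable s : gT.

(** The group ring is not declared commutative, so [horner_morph] asks for this commutation. *)
Lemma gring_const_comm : commr_rmorph gring_const (gring_elt R s : RG).
Proof.
move=> c; rewrite /GRing.comm gring_const_mul mul_gring_const.
by apply/ffunP => g; rewrite !ffunE mulrC.
Qed.

Definition gring_poly : {poly R} -> RG := horner_morph gring_const_comm.
HB.instance Definition _ := GRing.RMorphism.on gring_poly.

Lemma gring_polyX : gring_poly 'X = gring_elt R s.
Proof. exact: horner_morphX. Qed.

Lemma gring_polyXn k : gring_poly 'X^k = gring_elt R (s ^+ k)%g.
Proof. by rewrite rmorphXn /= gring_polyX gring_eltX. Qed.

Hypothesis s_gen : <[s]>%g = [set: gT].

(** The powers of [s] below its order are distinct, so no two monomials of [P] collide. *)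
Lemma gring_poly_coef (P : {poly R}) k :
  (size P <= #[s]%g)%N -> (k < #[s]%g)%N -> gring_poly P (s ^+ k)%g = P`_k.
Proof.
move=> szP ltk; rewrite /gring_poly /horner_morph.
rewrite (@horner_coef_wide _ #[s]%g); last first.
  by apply: leq_trans szP; rewrite size_poly.
rewrite sum_ffunE (bigD1 (Ordinal ltk)) //= coef_map /= gring_eltX.
rewrite gring_const_mul !ffunE eqxx mulr1 big1 ?addr0 // => i ik.
rewrite coef_map /= gring_eltX gring_const_mul !ffunE.
rewrite eq_expg_mod_order !modn_small //.
by move: ik; rewrite -val_eqE /= eq_sym => /negPf ->; rewrite mulr0.
Qed.

Lemma gring_poly_surj (u : RG) : exists P, u = gring_poly P.
Proof.
exists (\poly_(k < #[s]%g) u (s ^+ k)%g); apply/ffunP => g.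
have /cyclePmin[k ltk ->] : g \in <[s]>%g by rewrite s_gen inE.
by rewrite gring_poly_coef ?size_poly // coef_poly ltk.
Qed.

Lemma gring_poly_Xn_sub1 : gring_poly ('X^#[s]%g - 1) = 0.
Proof. by rewrite rmorphB /= gring_polyXn expg_order rmorph1 subrr. Qed.

(** After division by a monic polynomial, the coefficients of the remainder are read off its image,
    which is 0. *)
Lemma gring_poly_eq0 (P : {poly R}) :
  gring_poly P = 0 -> exists W, P = W * ('X^#[s]%g - 1).
Proof.
have monF := monicXnsubC (1 : R) (order_gt0 s).
have szF := size_XnsubC (1 : R) (order_gt0 s).
rewrite polyC1 in monF szF; rewrite (Pdiv.RingMonic.rdivp_eq monF P).
set Q := Pdiv.Ring.rdivp _ _; set r := Pdiv.Ring.rmodp _ _ => Pr.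
exists Q; suff -> : r = 0 by rewrite addr0.
have szr : (size r <= #[s]%g)%N.
  by rewrite -ltnS -szF Pdiv.Ring.ltn_rmodp monic_neq0.
move: Pr; rewrite rmorphD rmorphM /= gring_poly_Xn_sub1 mulr0 add0r => r0.
apply/polyP => k; rewrite coef0.
have [lek|ltk] := leqP #[s]%g k; first by rewrite nth_default ?(leq_trans szr).
by rewrite -gring_poly_coef // r0 ffunE.
Qed.

End GroupRingPoly.

(** * Linear combinations in quotient modules *)

Lemma quomod_pi0 (A : pzRingType) (V : lmodType A) (I : submodClosed V) :
  quomod_pi I 0 = 0.
Proof. by apply: (addrI (quomod_pi I 0)); rewrite -quomod_piD !addr0. Qed.

Lemma quomod_pi_sum (A : pzRingType) (V : lmodType A) (I : submodClosed V)
    (J : finType) (g : J -> V) :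
  quomod_pi I (\sum_j g j) = \sum_j quomod_pi I (g j).
Proof. exact: (big_morph _ (quomod_piD I) (quomod_pi0 I)). Qed.

Lemma quomod_pi_scale (A : pzRingType) (V : lmodType A) (I : submodClosed V)
    (c : A) (v : V) : c *: quomod_pi I v = quomod_pi I (c *: v).
Proof. exact: quomod_piZ. Qed.

Lemma quomod_pi_lin (A : pzRingType) (V : lmodType A) (I : submodClosed V)
    (J : finType) (u0 : A) (g0 : V) (u : J -> A) (g : J -> V) :
  u0 *: quomod_pi I g0 + \sum_j u j *: quomod_pi I (g j) =
  quomod_pi I (u0 *: g0 + \sum_j u j *: g j).
Proof.
rewrite quomod_piD quomod_pi_sum -quomod_pi_scale; congr (_ + _).
by apply: eq_bigr => j _; rewrite -quomod_pi_scale.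
Qed.

Lemma quomod_pi_eq0 (A : pzRingType) (V : lmodType A) (I : submodClosed V) v :
  quomod_pi I v = 0 <-> v \in I.
Proof.
rewrite -(quomod_pi0 I) -{2}[v]subr0.
by split=> [/quomod_piP|/quomod_piP].
Qed.

Lemma quomod_pi_rel (A : pzRingType) (V : lmodType A) (I : submodClosed V)
    (J : finType) (u0 : A) (g0 : V) (u : J -> A) (g : J -> V) :
  quomod_pi I (u0 *: g0 - \sum_j u j *: g j) = 0 ->
  u0 *: quomod_pi I g0 = \sum_j u j *: quomod_pi I (g j).
Proof.
move/quomod_pi_eq0/quomod_piP; rewrite -quomod_pi_scale quomod_pi_sum => ->.
by apply: eq_bigr => j _; rewrite quomod_pi_scale.
Qed.

(** * Powers of u - 1 modulo p *)

Section Frobenius.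

Variables (R : comNzRingType) (p : nat).
Hypothesis p_prime : prime p.

Lemma expr_sub1_prime (u : R) : exists c, (u - 1) ^+ p = u ^+ p - 1 + p%:R * c.
Proof.
have p_gt0 := prime_gt0 p_prime.
have [c Ec] : exists c, (u - 1) ^+ p = u ^+ p + (-1) ^+ p + p%:R * c.
  have neq0 : ord_max != ord0 :> 'I_p.+1 by rewrite -val_eqE /= -lt0n.
  rewrite exprDn (bigD1 ord0) //= (bigD1 ord_max) //=.
  rewrite subn0 expr0 mulr1 bin0 subnn expr0 mul1r binn !mulr1n addrA.
  suff [c ->] : pdvd (p%:R : R) 1
    (\sum_(i < p.+1 | (i != ord0) && (i != ord_max))
    u ^+ (p - i) * (-1) ^+ i *+ 'C(p, i)) by exists c; rewrite expr1.
  apply: pdvd_sum => i /andP[i0 ip].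
  rewrite -[X in pdvd _ _ X]mulr_natl; apply: pdvdMr.
  have /dvdnP[k ->] : (p %| 'C(p, i))%N.
    apply: prime_dvd_bin => //; rewrite lt0n [(_ != 0)%N]i0 /=.
    by rewrite ltn_neqAle -ltnS ltn_ord andbT; apply: ip.
  by exists k%:R; rewrite natrM expr1 mulrC.
have [p2|podd] := even_prime p_prime.
  (* For p = 2 the sign is off: (-1)^2 = -1 + 2, and the 2 goes into the multiple of p. *)
  by exists (c + 1); rewrite Ec p2; ring.
by exists c; rewrite Ec -signr_odd podd expr1.
Qed.

Lemma expr_sub1_prime_pow n (u : R) :
  exists c, (u - 1) ^+ (p ^ n) = u ^+ (p ^ n) - 1 + p%:R * c.
Proof.
elim: n u => [|n IHn] u; first by exists 0; rewrite !expr1 mulr0 addr0.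
have [c Ec] := IHn u; have [c' Ec'] := expr_sub1_prime (u ^+ (p ^ n)).
rewrite expnSr exprM Ec.
have [k Ek] : exists k, (u ^+ (p ^ n) - 1 + p%:R * c) ^+ p
                       = (u ^+ (p ^ n) - 1) ^+ p + p%:R * k.
  move: (u ^+ _ - 1) => z.
  (* The cofactor comes from factoring a difference of p-th powers whose bases differ by p c. *)
  exists (c * \sum_(i < p) (z + p%:R * c) ^+ (p.-1 - i) * z ^+ i).
  rewrite -[LHS](subrK (z ^+ p)) subrXX addrC addrAC subrr add0r mulrA.
  by congr (_ + _ * _); apply: eq_bigr => i _; rewrite subnS predn_sub.
by exists (c' + k); rewrite Ek Ec' exprM; ring.
Qed.

End Frobenius.

(** * Divisibility by p in Z/p^m *)

Section PrimePowerModulus.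

Variables (p m : nat).
Hypotheses (p_prime : prime p) (m_gt0 : (0 < m)%N).

Local Notation R := 'Z_(p ^ m).

Let pm_gt1 : (1 < p ^ m)%N.
Proof. by rewrite -{1}(expn0 p) ltn_exp2l ?prime_gt1. Qed.

Lemma Zp_natr_eq (k l : nat) : k%:R = l%:R :> R -> k = l %[mod p ^ m].
Proof. by move/(congr1 val); rewrite /= !val_Zp_nat. Qed.

Lemma pdvd_Zp_nat k : pdvd (p%:R : R) 1 k%:R <-> (p %| k)%N.
Proof.
have dvd_pm : (p %| p ^ m)%N by rewrite dvdn_exp.
split=> [[v]|/dvdnP[l ->]]; last by exists l%:R; rewrite natrM mulrC.
rewrite -(natr_Zp v) expr1 -natrM => /Zp_natr_eq e.
by rewrite /dvdn -(modn_dvdm _ dvd_pm) e modn_dvdm // -/(dvdn _ _) dvdn_mulr.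
Qed.

(** If p^k w = 0 in Z/p^m then p^(m-k) divides w, and m - k > 0; this is applied to w = u - p v. *)
Lemma pdvd_Zp_cancel k (u : R) : (k < m)%N ->
  pdvd (p%:R : R) k.+1 (p%:R ^+ k * u) -> pdvd (p%:R : R) 1 u.
Proof.
move=> ltkm [v e].
have dvd_p w : (p ^ m %| p ^ k * w -> p %| w)%N.
  rewrite -(subnKC (ltnW ltkm)) expnD dvdn_pmul2l ?expn_gt0 ?prime_gt0 //.
  by apply: dvdn_trans; rewrite dvdn_exp // subn_gt0.
have : p%:R ^+ k * (u - p%:R * v) = 0 by rewrite mulrBr e exprSr mulrA subrr.
rewrite -(natr_Zp (u - _)) -natrX -natrM => /(@Zp_natr_eq _ 0).
rewrite mod0n => /eqP/dvd_p/pdvd_Zp_nat.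
rewrite natr_Zp => uv; rewrite -(subrK (p%:R * v) u); apply: pdvdD => //.
by exists v.
Qed.

Lemma pdvd_Zp_prime (u v : R) : pdvd (p%:R : R) 1 (u * v) ->
  pdvd (p%:R : R) 1 u \/ pdvd (p%:R : R) 1 v.
Proof.
rewrite -(natr_Zp u) -(natr_Zp v) -natrM => /pdvd_Zp_nat.
by rewrite Euclid_dvdM // => /orP[]/pdvd_Zp_nat; [left|right].
Qed.

Lemma pdvd_Zp_nunit : ~ pdvd (p%:R : R) 1 1.
Proof.
rewrite -[X in pdvd _ _ X](mulr1n 1) => /pdvd_Zp_nat.
by rewrite dvdn1 => /eqP p1; have := p_prime; rewrite p1.
Qed.

Lemma Zp_prime_nilp : (p%:R : R) ^+ m = 0.
Proof. by apply: val_inj; rewrite -natrX /= val_Zp_nat // modnn. Qed.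

End PrimePowerModulus.

Lemma pdvd_int (R : comNzRingType) (p k : nat) (z : int) :
  ((p ^ k)%:Z %| z)%Z -> pdvd (p%:R : R) k z%:~R.
Proof. by case/dvdzP=> q ->; exists q%:~R; rewrite intrM mulrC -natrX. Qed.

(** * Divisibility of geometric sums by powers of p *)

Section GeometricSums.

Variables (R : comNzRingType) (p : nat).
Implicit Type D : R.

Local Notation pdvd := (pdvd (p%:R : R)).

Lemma geom_sumM D (u v : nat) :
  \sum_(s < u * v) D ^+ s = (\sum_(s < u) D ^+ s) * \sum_(r < v) (D ^+ u) ^+ r.
Proof.
elim: v => [|v IHv]; first by rewrite muln0 !big_ord0 mulr0.
rewrite mulnSr big_split_ord /= IHv big_ord_recr /= mulrDr; congr (_ + _).
by rewrite mulr_suml; apply: eq_bigr => i _; rewrite exprD -exprM mulrC.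
Qed.

Lemma pdvd_exp_sub1 D k : pdvd 1 (D - 1) -> pdvd 1 (D ^+ k - 1).
Proof. by move=> D1; rewrite subrX1; apply: pdvdMr. Qed.

Lemma pdvd_geom_prime D : pdvd 1 (D - 1) -> pdvd 1 (\sum_(r < p) D ^+ r).
Proof.
move=> D1; have -> : \sum_(r < p) D ^+ r = \sum_(r < p) (D ^+ r - 1) + p%:R.
  rewrite big_split /= sumr_const card_ord.
  by rewrite -[X in _ + X + _]mulr_natr mulN1r subrK.
apply: pdvdD; last by rewrite -[X in pdvd _ X]expr1; apply: pdvd_exp.
by apply: pdvd_sum => r _; apply: pdvd_exp_sub1.
Qed.

(** The sum factors into t sums of p terms, in D, D^p, D^(p^2) and so on; each is divisible by p
    because its terms are 1 modulo p. *)
Lemma pdvd_geom_prime_pow D t :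
  pdvd 1 (D - 1) -> pdvd t (\sum_(s < p ^ t) D ^+ s).
Proof.
move=> D1; elim: t => [|t IHt].
  by exists (\sum_(s < p ^ 0) D ^+ s); rewrite expr0 mul1r.
rewrite expnSr geom_sumM -addn1; apply: pdvdM => //.
exact/pdvd_geom_prime/pdvd_exp_sub1.
Qed.

End GeometricSums.

(** * Coordinates of combinations of generators and relators *)

Section RowCoordinates.

Variables (A : nzRingType) (k : nat) (u0 : A) (u : 'I_k -> A).

Let v : 'rV[A]_k.+1 :=
  u0 *: delta_mx 0 ord0 + \sum_j u j *: delta_mx 0 (lift ord0 j).

Lemma row_lin_coord0 : v 0 ord0 = u0.
Proof.
rewrite !mxE summxE big1 ?addr0 ?eqxx ?mulr1 // => j _.
by rewrite !mxE mulr0.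
Qed.

Lemma row_lin_coord j : v 0 (lift ord0 j) = u j.
Proof.
rewrite !mxE summxE (bigD1 j) //= !mxE !eqxx /= mulr0 add0r mulr1.
rewrite big1 ?addr0 // => i /negPf ij.
by rewrite !mxE (inj_eq lift_inj) eq_sym ij mulr0.
Qed.

Lemma row_linE (w : 'rV[A]_k.+1) :
  w 0 ord0 = u0 -> (forall j, w 0 (lift ord0 j) = u j) -> w = v.
Proof.
move=> w0 wj; rewrite [LHS]row_sum_delta big_ord_recl w0; congr (_ + _).
by apply: eq_bigr => j _; rewrite wj.
Qed.

End RowCoordinates.

Section RelatorCoordinates.

Variables (A : nzRingType) (k : nat) (u0 : A) (u t : 'I_k -> A).
Variable c : option 'I_k -> A.

(** The shape of [X_relator] with abstract entries. *)
Let r (l : option 'I_k) : 'rV[A]_k.+1 :=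
  if l is Some i then t i *: delta_mx 0 (lift ord0 i) - delta_mx 0 (lift ord0 i)
  else u0 *: delta_mx 0 ord0 - \sum_i u i *: delta_mx 0 (lift ord0 i).

Let r_None : r None = u0 *: delta_mx 0 ord0
                      + \sum_i - u i *: delta_mx 0 (lift ord0 i).
Proof.
by rewrite /r -sumrN; congr (_ + _); apply: eq_bigr => i _; rewrite scaleNr.
Qed.

Lemma relator_sum_coord0 : (\sum_l c l *: r l) 0 ord0 = c None * u0.
Proof.
rewrite summxE (bigD1 None) //.
have -> : (c None *: r None) 0 ord0 = c None * u0.
  by rewrite mxE r_None row_lin_coord0.
rewrite big1 => [|[i|] // _]; first exact: addr0.
by rewrite !mxE mulr0 subr0 mulr0.
Qed.

Lemma relator_sum_coord j :
  (\sum_l c l *: r l) 0 (lift ord0 j) = - c None * u j + c (Some j) * (t j - 1).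
Proof.
rewrite summxE (bigD1 None) // (bigD1 (Some j)) //.
have -> : (c None *: r None) 0 (lift ord0 j) = - c None * u j.
  by rewrite mxE r_None row_lin_coord mulrN mulNr.
rewrite big1 => [|[i|] //= ij].
  by rewrite /= addr0 !mxE !eqxx mulr1.
rewrite !mxE (inj_eq lift_inj) eq_sym.
have /negPf -> : i != j by apply: contraNneq ij => ->.
by rewrite mulr0 subrr mulr0.
Qed.

End RelatorCoordinates.

(** * The module X satisfies the criterion *)

Section ModuleXIndecomposable.

Variables (p n m : nat) (gT : finGroupType) (sigma : gT).
Variables (a : 'I_m -> option nat) (d : int).
Hypotheses (p_prime : prime p) (n_gt0 : (0 < n)%N) (m_gt0 : (0 < m)%N).
Hypotheses (sigma_gen : <[sigma]>%g = [set: gT]).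
Hypothesis cardG : #|[set: gT]| = (p ^ n)%N.
Hypothesis a_le_n : forall (i : 'I_m) (k : nat), a i = Some k -> (k <= n)%N.
Hypothesis d_U1 : d \in U p 1.
Hypothesis d_exp : forall i : 'I_m, d ^+ ninf_exp p (a i) \in U p i.+1.

Local Notation R := 'Z_(p ^ m).
Local Notation b := (p%:R : R).
Local Notation dR := (d%:~R : R).

Hypothesis geom_gap : forall (i j : 'I_m) k l, (i < j)%N ->
  a i = Some k -> a j = Some l ->
  (k <= l)%N /\ pdvd b (j - i).+1 (\sum_(s < p ^ (l - k)) (dR ^+ (p ^ k)) ^+ s).
Hypothesis ord0_gap : forall (i j : 'I_m) k, i = 0%N :> nat -> (i < j)%N ->
  a i = Some k -> a j -> (k + 2 <= n)%N.

Let order_sigma : #[sigma]%g = (p ^ n)%N.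
Proof. by rewrite orderE sigma_gen cardG. Qed.

Let dR_sub1 : pdvd b 1 (dR - 1).
Proof. by move: d_U1; rewrite inE => /(pdvd_int R); rewrite rmorphB. Qed.

Definition geom_poly (k t : nat) : {poly R} := \sum_(s < t) 'X^k ^+ s.

Lemma geom_polyE k t : 'X^(k * t) - 1 = geom_poly k t * ('X^k - 1).
Proof. by rewrite exprM subrX1 mulrC. Qed.

Lemma horner_geom_poly k t : (geom_poly k t).[dR] = \sum_(s < t) (dR ^+ k) ^+ s.
Proof. by rewrite horner_sum; apply: eq_bigr => s _; rewrite !hornerE. Qed.

Definition rel_poly (i : 'I_m) : {poly R} :=
  if a i is Some k then 'X^(p ^ k) - 1 else - 1.

Definition rel_copoly (i : 'I_m) : {poly R} :=
  if a i is Some k then geom_poly (p ^ k) (p ^ (n - k)) else - ('X^(p ^ n) - 1).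

(** Z/p^m may have zero divisors, but the leading coefficient is 1 or -1. *)
Lemma rel_poly_lreg i : GRing.lreg (rel_poly i).
Proof.
apply: lreg_lead; rewrite /rel_poly; case: (a i) => [k|].
  have /(monicXnsubC (1 : R))/monicP : (0 < p ^ k)%N.
    by rewrite expn_gt0 prime_gt0.
  by rewrite polyC1 => ->; apply: lreg1.
by rewrite lead_coefN lead_coef1 => u v; rewrite !mulN1r => /oppr_inj.
Qed.

Lemma rel_polyE i : 'X^(p ^ n) - 1 = rel_copoly i * rel_poly i.
Proof.
rewrite /rel_copoly /rel_poly; case ai: (a i) => [k|]; last first.
  by rewrite mulrNN mulr1.
by rewrite -geom_polyE -expnD subnKC // (a_le_n ai).
Qed.

Lemma horner_rel_poly j : a j -> pdvd b j.+1 (rel_poly j).[dR].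
Proof.
move=> aj; move: (d_exp j); rewrite /rel_poly inE; case: (a j) aj => // k _ /=.
by move/(pdvd_int R); rewrite rmorphB rmorphXn !hornerE.
Qed.

Lemma rel_poly_gap (i j : 'I_m) : (i < j)%N -> a j ->
  exists2 Phi : {poly R},
    rel_poly j = Phi * rel_poly i & pdvd b (j - i).+1 Phi.[dR].
Proof.
move=> ij aj; have fj := horner_rel_poly aj.
move: fj; rewrite /rel_poly; case ai: (a i) => [k|] fj; last first.
  (* Here f_i = -1, and f_j(d) is itself divisible by p^(j+1). *)
  exists (- rel_poly j); first by rewrite mulrNN mulr1.
  by rewrite hornerN; apply/pdvdN/pdvd_leq/fj; rewrite ltnS leq_subr.
case aj': (a j) aj fj => [l|] // _ _.
have [kl gap] := geom_gap ij ai aj'.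
exists (geom_poly (p ^ k) (p ^ (l - k))); last by rewrite horner_geom_poly.
by rewrite -geom_polyE -expnD subnKC.
Qed.

Lemma rel_copoly_split (i j : 'I_m) : i = 0%N :> nat -> (i < j)%N -> a j ->
  exists A B : {poly R},
    [/\ rel_copoly i = A * B, pdvd b 1 A.[dR] & pdvd b 1 B.[dR]].
Proof.
move=> i0 ij aj; rewrite /rel_copoly; case ai: (a i) => [k|]; last first.
  (* With a_0 infinite the cofactor is - (T^(p^n) - 1), which has the factor T - 1, and d = 1 modulo
     p. *)
  exists (- geom_poly 1 (p ^ n)), ('X - 1); split.
  - by rewrite mulNr -[in RHS](expr1 'X) -geom_polyE mul1n.
  - rewrite hornerN horner_geom_poly; apply/pdvdN/(pdvd_leq n_gt0).
    exact: pdvd_geom_prime_pow.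
  - by rewrite !hornerE.
have kn := ord0_gap i0 ij ai aj.
(* Since k + 2 <= n, one factor p can be split off the number of terms with at least another p left
   over. *)
exists (geom_poly (p ^ k * p) (p ^ (n - k).-1)), (geom_poly (p ^ k) p); split.
- rewrite /geom_poly -[in LHS](prednK (_ : 0 < n - k)%N) ?subn_gt0; last by lia.
  rewrite expnS geom_sumM mulrC; congr (_ * _); apply: eq_bigr => s _.
  by rewrite exprM.
- rewrite horner_geom_poly; apply: (@pdvd_leq _ _ _ (n - k).-1); first by lia.
  exact/pdvd_geom_prime_pow/pdvd_exp_sub1.
- by rewrite horner_geom_poly; apply/pdvd_geom_prime/pdvd_exp_sub1.
Qed.

Local Notation rho := (@gring_poly R gT sigma).

Lemma rho_rel_poly i : rho (rel_poly i) = sigma_exp sigma p m (a i) - 1.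
Proof.
rewrite /rel_poly /sigma_exp; case: (a i) => [k|]; last first.
  by rewrite rmorphN rmorph1 sub0r.
by rewrite rmorphB /= gring_polyXn rmorph1.
Qed.

Lemma rho_b_exp k : rho (b ^+ k)%:P = (p ^ k)%:R.
Proof. by rewrite -natrX polyC_natr rmorph_nat. Qed.

Lemma rho_XsubC : rho ('X - dR%:P) = gring_elt 'Z_(p ^ m) sigma - d%:~R.
Proof. by rewrite rmorphB /= gring_polyX rmorph_int rmorph_int. Qed.

Local Notation rel := (gen_submod (X_relator sigma p a d)).
Local Notation Xm := (quomod rel).

Definition X_y : Xm := quomod_pi rel (gen_y gT p m).
Definition X_x (i : 'I_m) : Xm := quomod_pi rel (gen_x gT p i).

Lemma X_lin (u0 : RG gT p m) (u : 'I_m -> RG gT p m) :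
  u0 *: X_y + \sum_j u j *: X_x j =
  quomod_pi rel (u0 *: gen_y gT p m + \sum_j u j *: gen_x gT p j).
Proof.
exact: quomod_pi_lin.
Qed.

Lemma X_lin_surj (z : Xm) : exists V : {poly R} * ('I_m -> {poly R}),
  z = lin rho X_y X_x V.1 V.2.
Proof.
pose v : 'rV[RG gT p m]_m.+1 := generic_quotient.repr z.
have [V EV] : exists V : 'I_m.+1 -> {poly R}, forall j, v 0 j = rho (V j).
  apply: (@fin_all_exists _ _ (fun j P => v 0 j = rho P)) => j.
  exact: gring_poly_surj.
exists (V ord0, fun j => V (lift ord0 j)); rewrite /lin /= X_lin.
have Ev : v = rho (V ord0) *: gen_y gT p m
              + \sum_j rho (V (lift ord0 j)) *: gen_x gT p j.
  by apply: row_linE => [|j]; rewrite EV.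
by rewrite -Ev quomod_piK.
Qed.

Lemma X_rel (k : option 'I_m) : quomod_pi rel (X_relator sigma p a d k) = 0.
Proof.
apply/quomod_pi_eq0; rewrite inE; apply/existsP; exists [ffun l => (l == k)%:R].
rewrite (bigD1 k) //= ffunE eqxx scale1r big1 ?addr0 // => l /negPf lk.
by rewrite ffunE lk scale0r.
Qed.

Lemma X_rel_x j : rho (rel_poly j) *: X_x j = 0.
Proof.
rewrite quomod_pi_scale -(X_rel (Some j)) /= rho_rel_poly scalerBl scale1r.
by [].
Qed.

Lemma X_rel_y :
  rho ('X - dR%:P) *: X_y = \sum_(j < m) rho (b ^+ j)%:P *: X_x j.
Proof.
apply: quomod_pi_rel; rewrite rho_XsubC.
have -> : \sum_(j < m) rho (b ^+ j)%:P *: gen_x gT p j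
        = \sum_(j < m) (p ^ j)%:R *: gen_x gT p j.
  by apply: eq_bigr => j _; rewrite rho_b_exp.
exact: (X_rel None).
Qed.

(** Comparing coordinates with a combination of relators gives identities in the group ring; lifted
    to polynomials, they hold up to multiples of T^(p^n) - 1. *)
Lemma X_lin_eq0 V0 V : lin rho X_y X_x V0 V = 0 ->
  exists (tau W : {poly R}) (C : 'I_m -> {poly R}),
    V0 = tau * ('X - dR%:P) + W * ('X^(p ^ n) - 1) /\
    forall j, V j = - (b ^+ j)%:P * tau + C j * rel_poly j.
Proof.
rewrite /lin X_lin => /quomod_pi_eq0; rewrite inE => /existsP[c /eqP Ec].
have [tau Etau] := gring_poly_surj sigma_gen (c None).
have [C EC] : exists C : 'I_m -> {poly R}, forall j, c (Some j) = rho (C j).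
  apply: (@fin_all_exists _ _ (fun j P => c (Some j) = rho P)) => j.
  exact: gring_poly_surj.
have kerP (P Q : {poly R}) : rho P = rho Q ->
    exists W, P = Q + W * ('X^(p ^ n) - 1).
  move=> PQ; have [W EW] : exists W, P - Q = W * ('X^(p ^ n) - 1).
    rewrite -order_sigma; apply: gring_poly_eq0 => //.
    by rewrite rmorphB /= PQ subrr.
  by exists W; rewrite -EW addrC subrK.
have [W EW] : exists W, V0 = tau * ('X - dR%:P) + W * ('X^(p ^ n) - 1).
  apply: kerP; rewrite rmorphM /= rho_XsubC -Etau.
  move/(congr1 (fun v : 'rV_m.+1 => v 0 ord0)): Ec.
  rewrite row_lin_coord0 => ->.
  exact: relator_sum_coord0.
have [D ED] : exists D : 'I_m -> {poly R}, forall j,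
    V j = (- (b ^+ j)%:P * tau + C j * rel_poly j) + D j * ('X^(p ^ n) - 1).
  apply: (@fin_all_exists _ _ (fun j D => V j = _ + D * _)) => j.
  apply: kerP; rewrite rmorphD !rmorphM rmorphN /= rho_b_exp rho_rel_poly.
  rewrite -Etau -EC.
  move/(congr1 (fun v : 'rV_m.+1 => v 0 (lift ord0 j))): Ec.
  rewrite row_lin_coord => ->; rewrite mulNr mulr_natl -mulr_natr -mulNr.
  exact: relator_sum_coord.
(* In the x-coordinates the multiple of T^(p^n) - 1 is absorbed into that of f_j, which divides
   it. *)
exists tau, W, (fun j => C j + D j * rel_copoly j); split=> // j.
by rewrite ED (rel_polyE j); ring.
Qed.

Lemma X_x_eq0 j : ~~ a j -> X_x j = 0.
Proof.
move=> aj; have := X_rel_x j; rewrite /rel_poly; case: (a j) aj => // _.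
by rewrite rmorphN rmorph1 scaleN1r => /eqP; rewrite oppr_eq0 => /eqP.
Qed.

Theorem X_indecomposable : indecomposable (X sigma p a d).
Proof.
have pn_gt0 : (0 < p ^ n)%N by rewrite expn_gt0 prime_gt0.
have b_pn : pdvd b 1 (p ^ n)%:R.
  by rewrite natrX; apply: pdvd_leq (pdvd_exp _ _).
apply: (@presented_indecomposable _ b dR m (p ^ n) _ _ _ _ _
  ('X^(p ^ n) - 1) _ _ _
  rel_poly rel_copoly (fun i => a i) _ _ _ _ _ _ Xm rho X_y X_x).
- by move=> k u; apply: pdvd_Zp_cancel.
- exact: Zp_prime_nilp.
- exact: pdvd_Zp_prime.
- exact: pdvd_Zp_nunit.
- exact: dR_sub1.
- by rewrite !hornerE; apply: pdvd_exp_sub1.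
- rewrite derivB derivXn derivC subr0 hornerMn -[X in pdvd _ _ X]mulr_natl.
  exact: pdvdMr.
- have [c ->] := expr_sub1_prime_pow p_prime n ('X : {poly R}).
  by exists c; rewrite -polyC_natr.
- exact: rel_poly_lreg.
- exact: rel_polyE.
- exact: horner_rel_poly.
- exact: rel_poly_gap.
- exact: rel_copoly_split.
- exact: X_lin_surj.
- exact: X_rel_y.
- exact: X_rel_x.
- exact: X_lin_eq0.
- by rewrite -order_sigma; apply: gring_poly_Xn_sub1.
- exact: X_x_eq0.
Qed.

End ModuleXIndecomposable.

(** * From the conditions on a and d to the divisibility estimates *)

Lemma pdvd_geom_gap (R : comNzRingType) (p k l j : nat) (D : R) :
  pdvd (p%:R : R) 1 (D - 1) -> (k + j < l)%N ->
  (k <= l)%N /\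
  pdvd (p%:R : R) j.+1 (\sum_(s < p ^ (l - k)) (D ^+ (p ^ k)) ^+ s).
Proof.
move=> D1 kjl; split; first by lia.
apply: (@pdvd_leq _ _ _ (l - k)); first by lia.
exact/pdvd_geom_prime_pow/pdvd_exp_sub1.
Qed.

Lemma negU_leq p k l d : (k <= l)%N -> d \in negU p l -> d \in negU p k.
Proof.
move=> kl; rewrite !inE; apply: dvdz_trans; rewrite dvdzE /=.
exact: dvdn_exp2l.
Qed.

(* The factor 1 + d of the geometric sum contributes the 2-adic valuation of
   d + 1, the remaining sum (in d ^+ 2) only 2 ^ l.-1. *)
Lemma pdvd_geom_negU (R : comNzRingType) (d : int) (j l : nat) :
  (0 < l)%N -> d \in U 2 1 -> d \notin U 2 2 ->
  (forall v, (2 <= v)%N -> d \in negU 2 v -> d \notin negU 2 v.+1 ->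
    (v <= j)%N -> (j - (v - 1) < l)%N) ->
  pdvd (2%:R : R) j.+1 (\sum_(s < 2 ^ l) d%:~R ^+ s).
Proof.
move=> l_gt0 dU1 dU2 v_gap.
have d_negU2 : d \in negU 2 2 by move: dU1 dU2; rewrite !inE; lia.
(* The order of d + 1 at 2 is capped at j + 1, which also covers d = -1; below the cap it is the v
   of the hypothesis. *)
have [w dw jw] : exists2 w, d \in negU 2 w & (j.+1 <= w + l.-1)%N.
  have [dj|ndj] := boolP (d \in negU 2 j.+1); first by exists j.+1; lia.
  have exw : exists w, d \notin negU 2 w by exists j.+1.
  case: (ex_minnP exw) => -[|v] nv vmin.
    by rewrite (negU_leq _ d_negU2) in nv.
  have v_gt1 : (1 < v)%N.
    by rewrite ltnNge; apply: contraNN nv => le_v1; apply: negU_leq d_negU2.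
  have dv : d \in negU 2 v.
    by apply: contraT => /vmin; rewrite ltnn.
  by exists v => //; have := v_gap v v_gt1 dv nv; have := vmin _ ndj; lia.
rewrite -(prednK l_gt0) expnS geom_sumM; apply: pdvd_leq jw _; apply: pdvdM.
  have -> : \sum_(s < 2) (d%:~R : R) ^+ s = - (- d - 1)%:~R.
    rewrite !big_ord_recl big_ord0 addr0 expr0 expr1 rmorphB rmorphN /=.
    by ring.
  by apply/pdvdN/pdvd_int; move: dw; rewrite !inE.
apply/pdvd_geom_prime_pow/pdvd_exp_sub1.
by move: dU1; rewrite inE => /(pdvd_int R); rewrite rmorphB.
Qed.

Theorem theorem1 (p n m : nat) (gT : finGroupType) (sigma : gT)
    (a : 'I_m -> option nat) (d : int)
    (p_prime : prime p) (n_gt0 : (0 < n)%N) (m_gt0 : (0 < m)%N)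
    (sigma_gen : <[sigma]>%g = [set: gT]) (cardG : #|[set: gT]| = (p ^ n)%N)
    (a_le_n : forall (i : 'I_m) (k : nat), a i = Some k -> (k <= n)%N)
    (d_U1 : d \in U p 1)
    (d_exp : forall i : 'I_m, d ^+ ninf_exp p (a i) \in U p i.+1) :
  let a0 := a (Ordinal m_gt0) in
  (odd p ->
   (forall (i k : 'I_m) (j : nat),
      (1 <= j)%N -> k = (i + j)%N :> nat -> a k <> None ->
      ninf_lt (ninf_add (a i) j) (a k)) ->
   indecomposable (X sigma p a d))
  /\
  (p = 2%N ->
   (n = 1%N -> a0 = None) ->
   (forall (i k : 'I_m) (j : nat),
      (1 <= j)%N -> k = (i + j)%N :> nat -> a k <> None ->
      ~ [/\ d \notin U p 2, i = 0%N :> nat & a0 = Some 0%N] ->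
      ninf_lt (ninf_add (a i) j) (a k)) ->
   (d \notin U p 2 -> a0 = Some 0%N ->
    forall j : 'I_m, (1 <= j)%N -> a j <> Some 0%N) ->
   ((2 <= m)%N ->
    forall v : nat, (2 <= v)%N -> d \in negU p v -> d \notin negU p v.+1 ->
    a0 = Some 0%N ->
    forall i : 'I_m, (v <= i)%N -> a i <> None ->
      ninf_lt (Some (i - (v - 1))%N) (a i)) ->
   indecomposable (X sigma p a d)).
Proof.
move=> a0; have dR_sub1 : pdvd (p%:R : 'Z_(p ^ m)) 1 (d%:~R - 1).
  by move: d_U1; rewrite inE => /(pdvd_int 'Z_(p ^ m)); rewrite rmorphB.
split=> [_ gap|p2 n1 gap exc_neq0 exc_gap].
  have gap' (i j : 'I_m) k l : (i < j)%N -> a i = Some k -> a j = Some l ->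
      (k + (j - i) < l)%N.
    move=> ij ai aj; have := gap i j (j - i)%N.
    by rewrite ai aj /=; apply => //; lia.
  apply: (X_indecomposable p_prime n_gt0 m_gt0 sigma_gen cardG a_le_n) => //.
    by move=> i j k l ij ai aj; apply: pdvd_geom_gap (gap' _ _ _ _ ij ai aj).
  (* From k + (j - i) < l <= n and i < j follows k + 2 <= n. *)
  move=> i j k i0 ij ai; case aj: (a j) => [l|] // _.
  by have := gap' _ _ _ _ ij ai aj; have := a_le_n _ _ aj; lia.
have gap' (i j : 'I_m) k l : (i < j)%N -> a i = Some k -> a j = Some l ->
    ~ [/\ d \notin U p 2, i = 0%N :> nat & a0 = Some 0%N] ->
    (k + (j - i) < l)%N.
  move=> ij ai aj exc; have := gap i j (j - i)%N.
  by rewrite ai aj /=; apply => //; lia.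
have exc_dec (i : 'I_m) :
    ~ [/\ d \notin U p 2, i = 0%N :> nat & a0 = Some 0%N] \/
    [/\ d \notin U p 2, i = 0%N :> nat & a0 = Some 0%N].
  case: (boolP [&& d \notin U p 2, i == 0%N :> nat & a0 == Some 0%N]) => exc.
    by right; case/and3P: exc => ? /eqP ? /eqP.
  by left=> -[d2 i0 a00]; move: exc; rewrite d2 i0 a00 !eqxx.
have a_ord0 (i : 'I_m) : i = 0%N :> nat -> a i = a0.
  by move=> i0; congr a; apply: val_inj.
subst p.
apply: (X_indecomposable p_prime n_gt0 m_gt0 sigma_gen cardG a_le_n) => //.
  (* In the exceptional case k = 0 and the sum runs over powers of d itself; a_j != 0 makes it start
     with the factor 1 + d, and condition (iii) bounds the order. *)
  move=> i j k l ij ai aj; have [exc|[d2 i0 a00]] := exc_dec i.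
    exact: pdvd_geom_gap (gap' _ _ _ _ ij ai aj exc).
  have k0 : k = 0%N by move: ai; rewrite (a_ord0 i i0) a00 => -[].
  rewrite k0 i0 subn0 expn0 expr1 subn0; split=> //.
  rewrite i0 in ij; apply: pdvd_geom_negU => // [|v v2 dv dv' vj].
    by case: l aj => // aj; case: (exc_neq0 d2 a00 j ij).
  have m_ge2 : (2 <= m)%N by apply: leq_ltn_trans ij (ltn_ord j).
  have := exc_gap m_ge2 v v2 dv dv' a00 j vj.
  by rewrite aj; apply.
move=> i j k i0 ij ai; case aj: (a j) => [l|] // _.
have [exc|[d2 _ a00]] := exc_dec i.
  by have := gap' _ _ _ _ ij ai aj exc; have := a_le_n _ _ aj; lia.
(* Now k = 0, and n >= 2 is what condition (i) gives for a_0 = 0. *)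
move: ai; rewrite (a_ord0 i i0) a00 => -[<-].
have n_neq1 : n <> 1%N by move=> /n1; rewrite a00.
by lia.
Qed.
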